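(* If a graph $H$ contains an induced cycle of length at least $5$, then the class of $H$-subdivisions does not have the induced Erdős–Pósa property.
   Context: All graphs are finite and simple. A subdivision of $H$ is a graph obtained from $H$ by repeatedly replacing an edge by a path of length $2$ through a new vertex. An induced subdivision of $H$ in $G$ is an induced subgraph of $G$ isomorphic to a subdivision of $H$. The class of $H$-subdivisions has the induced Erdős–Pósa property if there is a function $f:\mathbb N\to\mathbb R$ such that for every graph $G$ and every positive integer $k$, $G$ contains either $k$ pairwise vertex-disjoint induced subdivisions of $H$ or a set of at most $f(k)$ vertices meeting every induced subdivision of $H$. *)

(* Defs.v *)
From HB Require Import structures.
From mathcomp Require Import all_boot.
Set Implicit Arguments. Unset Strict Implicit. Unset Printing Implicit Defensive.

Record sgraph := SGraph {
  svert :> finType;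
  sadj : rel svert;
  sadj_sym : symmetric sadj;
  sadj_irr : irreflexive sadj }.
Arguments sadj : clear implicits.

Definition giso (G1 G2 : sgraph) : Prop :=
  exists f : G1 -> G2, bijective f /\ forall x y, sadj G2 (f x) (f y) = sadj G1 x y.

(* Subdividing the pair {u,v} of G: new vertex None adjacent exactly to u and v,
   the edge uv removed. Used below only when uv is an edge. *)
Section Subdivide.
Variables (G : sgraph) (u v : G).
Definition sub_adj (a b : option G) : bool :=
  match a, b with
  | Some x, Some y => sadj G x y && ~~ (((x == u) && (y == v)) || ((x == v) && (y == u)))
  | None, Some x => (x == u) || (x == v)
  | Some x, None => (x == u) || (x == v)
  | None, None => false
  end.
Lemma sub_adj_sym : symmetric sub_adj.
Proof.
case=> [x|] [y|] //=; rewrite sadj_sym; congr (_ && ~~ _).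
by rewrite orbC [(y == u) && _]andbC [(y == v) && _]andbC.
Qed.
Lemma sub_adj_irr : irreflexive sub_adj.
Proof. by case=> [x|] //=; rewrite sadj_irr. Qed.
Definition subdivide : sgraph := SGraph sub_adj_sym sub_adj_irr.
End Subdivide.

Inductive is_subdivision (H : sgraph) : sgraph -> Prop :=
| subdiv_iso G : giso H G -> is_subdivision H G
| subdiv_step (G : sgraph) (u v : G) G' :
    is_subdivision H G -> sadj G u v -> giso (subdivide u v) G' -> is_subdivision H G'.

Section Induced.
Variables (G : sgraph) (S : {set G}).
Definition ind_type : finType := {x : G | x \in S}.
Definition ind_adj (a b : ind_type) : bool := sadj G (val a) (val b).
Lemma ind_adj_sym : symmetric ind_adj.
Proof. by move=> a b; rewrite /ind_adj sadj_sym. Qed.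
Lemma ind_adj_irr : irreflexive ind_adj.
Proof. by move=> a; rewrite /ind_adj sadj_irr. Qed.
Definition induced : sgraph := SGraph ind_adj_sym ind_adj_irr.
End Induced.

Definition induces_subdivision (H G : sgraph) (S : {set G}) : Prop :=
  is_subdivision H (induced S).

(* The cycle C_n on 'I_n (a simple graph; a cycle for n >= 3). *)
Section Cycle.
Variable n : nat.
Definition cyc_adj (i j : 'I_n) : bool :=
  (i != j) && ((j == (i.+1 %% n) :> nat) || (i == (j.+1 %% n) :> nat)).
Lemma cyc_adj_sym : symmetric cyc_adj.
Proof. by move=> i j; rewrite /cyc_adj eq_sym orbC. Qed.
Lemma cyc_adj_irr : irreflexive cyc_adj.
Proof. by move=> i; rewrite /cyc_adj eqxx. Qed.
Definition cycle_graph : sgraph := SGraph cyc_adj_sym cyc_adj_irr.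
End Cycle.

Definition has_induced_long_cycle (H : sgraph) : Prop :=
  exists (C : {set H}) (n : nat), 5 <= n /\ giso (cycle_graph n) (induced C).

Definition induced_EP (H : sgraph) : Prop :=
  exists f : nat -> nat, forall (G : sgraph) (k : nat), 0 < k ->
    (exists F : 'I_k -> {set G},
        (forall i, induces_subdivision H (F i)) /\
        (forall i j, i != j -> [disjoint F i & F j]))
    \/
    (exists X : {set G}, #|X| <= f k /\
        forall S : {set G}, induces_subdivision H S -> ~~ [disjoint S & X]).

(* Main.v *)
Require Import Defs.
From mathcomp Require Import all_boot zify.
Set Implicit Arguments. Unset Strict Implicit. Unset Printing Implicit Defensive.

(** Call a set of vertices a core if it induces a graph of minimum degree at least 2, and
    a wide core if that graph moreover has no cycle of length 3 or 4.

    Replace every edge of [H] by a long path on which every second vertex is a gate, take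
    [n] copies of the resulting graph, and identify gates in pairs so that any two paths
    in distinct copies share a gate; then join completely the non-gates of distinct
    copies, and each non-gate to all gates foreign to its copy.  Gates stay pairwise
    nonadjacent.

    A wide core leaves no room for a complete join, so it lies inside one copy; there it
    contains a whole path, whose interior vertices have degree 2.  Every subdivision of
    [H] inherits a wide core from the long cycle of [H].  An induced subdivision has
    bounded degree, so it lies in the same copy as its wide core, since a foreign vertex
    sees all the non-gates of that path.  Hence two subdivisions in distinct copies share
    a gate.  Two in the same copy meet as well: the maximal number of disjoint cores is
    invariant under subdivision, so it is attained inside each of them, and no core of
    the copy avoids such a packing.  Each vertex is in at most two copies, so a set [X]
    misses one of the copies as soon as [n > 2 |X|]. *)

(** * Embeddings and subdivisions *)

Definition embedding (G1 G2 : sgraph) (f : G1 -> G2) : Prop :=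
  injective f /\ {mono f : x y / sadj G1 x y >-> sadj G2 x y}.

Lemma embedding_comp (G1 G2 G3 : sgraph) (f : G1 -> G2) (g : G2 -> G3) :
  embedding f -> embedding g -> embedding (g \o f).
Proof. by case=> fI fE [gI gE]; split=> [|x y]; [exact: inj_comp | rewrite /= gE fE]. Qed.

Lemma embedding_val (G : sgraph) (S : {set G}) : @embedding (induced S) G val.
Proof. by split; first exact: val_inj. Qed.

Lemma giso_embedding (G1 G2 : sgraph) :
  giso G1 G2 -> exists f : G1 -> G2, embedding f.
Proof. by case=> f [/bij_inj fI fE]; exists f. Qed.

Lemma embedding_giso (G1 G2 : sgraph) (f : G1 -> G2) :
  embedding f -> #|G2| <= #|G1| -> giso G1 G2.
Proof. by case=> fI fE le; exists f; split=> //; apply: inj_card_bij. Qed.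

Lemma embedding_giso_induced (G1 G2 : sgraph) (f : G1 -> G2) (S : {set G2}) :
  embedding f -> S =i codom f -> giso G1 (induced S).
Proof.
move=> [fI fE] Sf; have fS x : f x \in S by rewrite Sf codom_f.
apply: (@embedding_giso _ (induced S) (fun x => Sub (f x) (fS x))).
  by split=> [x y /(congr1 val)/fI|x y]; last exact: fE.
by rewrite card_sig -(card_codom fI); apply/subset_leq_card/subsetP=> y; rewrite !inE Sf.
Qed.

Lemma giso_induced_preimset (G1 G2 : sgraph) (f : G1 -> G2) (S : {set G2}) :
  embedding f -> S \subset codom f -> giso (induced (f @^-1: S)) (induced S).
Proof.
move=> f_emb /subsetP Sf.
apply: (embedding_giso_induced (embedding_comp (embedding_val _) f_emb)) => y.
apply/idP/codomP => [yS|[x ->]]; last by have := valP x; rewrite inE.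
have /codomP[x def_y] := Sf y yS.
have xS : x \in f @^-1: S by rewrite inE -def_y.
by exists (Sub x xS).
Qed.

Lemma giso_sym (G1 G2 : sgraph) : giso G1 G2 -> giso G2 G1.
Proof.
case=> f [[g fK gK] fE]; exists g; split; first by exists f.
by move=> x y; rewrite -fE !gK.
Qed.

Lemma giso_trans (G1 G2 G3 : sgraph) : giso G1 G2 -> giso G2 G3 -> giso G1 G3.
Proof.
case=> f [fB fE] [g [gB gE]]; exists (g \o f); split; first exact: bij_comp.
by move=> x y; rewrite /= gE fE.
Qed.

Lemma subdivision_giso (H G G' : sgraph) :
  is_subdivision H G -> giso G G' -> is_subdivision H G'.
Proof.
case=> [{}G iso|{}G u v G1 sG uv iso] iso'.
  exact: subdiv_iso (giso_trans iso iso').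
exact: subdiv_step sG uv (giso_trans iso iso').
Qed.

Lemma subdivision_preserves (P : sgraph -> Prop) :
  (forall G1 G2, giso G1 G2 -> P G1 -> P G2) ->
  (forall (G : sgraph) (u v : G), sadj G u v -> P G -> P (subdivide u v)) ->
  forall H G, is_subdivision H G -> P H -> P G.
Proof.
move=> Piso Psub H G sG PH; elim: sG => [{}G iso|{}G u v G' _ PG uv iso].
  exact: Piso iso PH.
exact: Piso iso (Psub _ _ _ uv PG).
Qed.

(** * Cores *)

Section Core.
Variable G : sgraph.
Implicit Types A : {set G}.

Definition nbh A (x : G) : {set G} := [set y in A | sadj G x y].

Definition core A : Prop := A != set0 /\ {in A, forall x, 1 < #|nbh A x|}.

Definition triangle_free A : Prop :=
  {in A & &, forall x y z, sadj G x y -> sadj G y z -> ~~ sadj G z x}.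

Definition square_free A : Prop :=
  {in A & &, forall x y z, {in A, forall t, x != z -> y != t ->
     sadj G x y -> sadj G y z -> sadj G z t -> ~~ sadj G t x}}.

(* An induced cycle of length at least 5 is a wide core, but degrees above 2 are allowed. *)
Definition wide_core A : Prop := [/\ core A, triangle_free A & square_free A].

Definition has_wide_core : Prop := exists A, wide_core A.

Definition degree_le (d : nat) : Prop := forall x, #|nbh [set: G] x| <= d.

Lemma core_other_nbr A x y : core A -> x \in A ->
  exists z, [/\ z \in A, y != z & sadj G x z].
Proof.
case=> _ cA /cA; rewrite (cardsD1 y) => Nx.
have /card_gt0P[z] : 0 < #|nbh A x :\ y| by case: (y \in _) Nx => // /ltnW.
by rewrite !inE eq_sym => /and3P[? ? ?]; exists z.
Qed.

End Core.

Section EmbeddedCore.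
Variables (G1 G2 : sgraph) (f : G1 -> G2).
Hypothesis f_emb : embedding f.
Let fI : injective f := f_emb.1.
Let fE : {mono f : x y / sadj G1 x y >-> sadj G2 x y} := f_emb.2.

Lemma nbh_imset (A : {set G1}) x : nbh (f @: A) (f x) = f @: nbh A x.
Proof.
apply/setP=> z; rewrite inE; apply/andP/imsetP.
  by case=> /imsetP[y Ay ->]; rewrite fE => xy; exists y; rewrite // inE Ay.
by case=> y; rewrite inE => /andP[Ay xy] ->; rewrite imset_f ?fE.
Qed.

Lemma core_imset (A : {set G1}) : core (f @: A) <-> core A.
Proof.
rewrite /core imset_eq0; split=> -[Ane dA]; split=> //.
  by move=> x Ax; have := dA _ (imset_f f Ax); rewrite nbh_imset card_imset.
by move=> _ /imsetP[x Ax ->]; rewrite nbh_imset card_imset ?dA.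
Qed.

Lemma wide_core_imset (A : {set G1}) : wide_core A -> wide_core (f @: A).
Proof.
case=> /core_imset cA tA qA; split=> //.
  by move=> _ _ _ /imsetP[x Ax ->] /imsetP[y Ay ->] /imsetP[z Az ->]; rewrite !fE; apply: tA.
move=> _ _ _ /imsetP[x Ax ->] /imsetP[y Ay ->] /imsetP[z Az ->] _ /imsetP[t At ->].
by rewrite !fE !(inj_eq fI); apply: qA.
Qed.

End EmbeddedCore.

Lemma core_preimset (G1 G2 : sgraph) (f : G1 -> G2) (A : {set G2}) :
  embedding f -> A \subset codom f -> core A -> core (f @^-1: A).
Proof.
move=> f_emb /subsetP Af cA; apply/(core_imset f_emb).
suff -> : f @: (f @^-1: A) = A by [].
apply/setP=> y; apply/imsetP/idP=> [[x + ->]|Ay]; first by rewrite inE.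
by have /codomP[x def_y] := Af y Ay; exists x; rewrite // inE -def_y.
Qed.

Lemma card_nbh_induced (G : sgraph) (S : {set G}) (x : induced S) :
  #|nbh [set: induced S] x| = #|nbh S (val x)|.
Proof.
rewrite -(card_imset _ val_inj) -(nbh_imset (embedding_val S)); congr #|pred_of_set (nbh _ _)|.
apply/setP=> y; apply/imsetP/idP=> [[z _ ->]|Sy]; first exact: valP.
by exists (Sub y Sy).
Qed.

Lemma wide_core_cycle (n : nat) : 5 <= n -> @wide_core (cycle_graph n) [set: 'I_n].
Proof.
move=> n5; have n_gt0 : 0 < n by lia.
have adjE (i j : 'I_n) : cyc_adj i j =
    [|| j == i.+1 :> nat, i == j.+1 :> nat, (i == 0 :> nat) && (j.+1 == n)
      | (j == 0 :> nat) && (i.+1 == n)].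
  have modS (k : 'I_n) : k.+1 %% n = if k.+1 == n then 0 else k.+1.
    by case: eqP (ltn_ord k) => [->|ne lt]; [rewrite modnn | rewrite modn_small; lia].
  have := ltn_ord i; have := ltn_ord j.
  rewrite /cyc_adj !modS -val_eqE /=; case: (i.+1 =P n); case: (j.+1 =P n); lia.
split.
- split; first by apply/set0Pn; exists (Ordinal n_gt0).
  move=> x _; have xn := ltn_ord x.
  have ltS : (if x.+1 == n then 0 else x.+1) < n by case: (x.+1 =P n); lia.
  have ltP : (if x == 0 :> nat then n.-1 else x.-1) < n by case: (x =P 0 :> nat); lia.
  apply/card_gt1P; exists (Ordinal ltS), (Ordinal ltP); rewrite !inE /= !adjE -val_eqE /=.
  by split; case: (x.+1 =P n); case: (nat_of_ord x =P 0); lia.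
- move=> x y z _ _ _; rewrite /= !adjE.
  have := ltn_ord x; have := ltn_ord y; have := ltn_ord z; lia.
- move=> x y z _ _ _ t _; rewrite /= !adjE -!val_eqE /=.
  have := ltn_ord x; have := ltn_ord y; have := ltn_ord z; have := ltn_ord t; lia.
Qed.

(** * Cores of subdivisions *)

Section SubdividedEdge.
Variables (G : sgraph) (u v : G).
Hypothesis uv : sadj G u v.
Local Notation G' := (subdivide u v).
Local Notation is_uv x y := (((x == u) && (y == v)) || ((x == v) && (y == u))).
Implicit Types (A : {set G}) (x y : G).

Definition redirect x y : G' := if is_uv x y then None else Some y.

Definition sub_lift A : {set G'} :=
  [set z : option G | if z is Some x then x \in A else (u \in A) && (v \in A)].

Let uv_neq : u != v.
Proof. by apply: contraTneq uv => ->; rewrite sadj_irr. Qed.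

Lemma redirect_inj x : injective (redirect x).
Proof.
move=> y z; rewrite /redirect; case: ifP => [yN|_]; case: ifP => [zN|_] //; last by case.
case/orP: yN zN => /andP[/eqP-> /eqP->]; rewrite eqxx.
  by rewrite (negPf uv_neq) orbF => /eqP.
by rewrite eq_sym (negPf uv_neq) => /eqP.
Qed.

Lemma nbh_sub_lift A x : x \in A -> nbh (sub_lift A) (Some x) = redirect x @: nbh A x.
Proof.
have vu : sadj G v u by rewrite sadj_sym.
move=> Ax; apply/setP=> z; rewrite inE; apply/andP/imsetP.
  case: z => [y|]; rewrite inE /=.
    case=> Ay /andP[xy ne]; exists y; first by rewrite inE Ay.
    by rewrite /redirect (negPf ne).
  case=> /andP[Au Av] /orP[]/eqP->; [exists v | exists u];
    by rewrite ?inE ?Au ?Av // /redirect !eqxx ?orbT.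
case=> y; rewrite inE /redirect => /andP[Ay xy] ->; case: ifPn => [|ne].
  by case/orP=> /andP[/eqP ex /eqP ey]; rewrite inE /= -?ex -?ey Ax Ay eqxx ?orbT.
by rewrite inE /= Ay xy ne.
Qed.

Lemma card_nbh_sub_lift A x : x \in A -> #|nbh (sub_lift A) (Some x)| = #|nbh A x|.
Proof. by move=> Ax; rewrite nbh_sub_lift // card_imset //; apply: redirect_inj. Qed.

Lemma nbh_sub_new (A : {set G'}) : nbh A None \subset [set Some u; Some v].
Proof. by apply/subsetP=> -[y|]; rewrite !inE // => /andP[_]. Qed.

Lemma core_sub_lift A : core A -> core (sub_lift A).
Proof.
case=> /set0Pn[x0 Ax0] dA; split; first by apply/set0Pn; exists (Some x0); rewrite inE.
case=> [x|]; rewrite inE; [move=> Ax | case/andP=> Au Av]; first by rewrite card_nbh_sub_lift ?dA.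
by apply/card_gt1P; exists (Some u), (Some v); rewrite !inE Au Av /= !eqxx orbT uv_neq.
Qed.

Lemma core_sub_new (A : {set G'}) :
  core A -> None \in A -> (Some u \in A) && (Some v \in A).
Proof.
case=> _ dA /dA N2; have sN := nbh_sub_new A.
have eN : nbh A None = [set Some u; Some v].
  by apply/eqP; rewrite eqEcard sN (leq_trans _ N2) // cards2; case: (_ != _).
have : Some u \in nbh A None by rewrite eN !inE eqxx.
have : Some v \in nbh A None by rewrite eN !inE eqxx orbT.
by rewrite !inE => /andP[-> _] /andP[-> _].
Qed.

Lemma core_sub_unlift (A : {set G'}) : core A -> core (Some @^-1: A : {set G}).
Proof.
move=> cA; case: (cA) => /set0Pn[z0 Az0] dA; split.
  apply/set0Pn; case: z0 Az0 => [x|N]; first by exists x; rewrite inE.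
  by case/andP: (core_sub_new cA N) => Au _; exists u; rewrite inE.
move=> x xA; rewrite -card_nbh_sub_lift //; rewrite inE in xA.
apply: leq_trans (dA _ xA) _; apply/subset_leq_card/subsetP=> -[y|]; rewrite !inE //.
by case/andP=> /(core_sub_new cA)/andP[-> ->].
Qed.

Lemma sub_adj_new (z : G') : sadj G' None z -> z = Some u \/ z = Some v.
Proof. by case: z => [x|//] /= /orP[]/eqP->; [left | right]. Qed.

Lemma sub_adj_old x y : sadj G' (Some x) (Some y) -> sadj G x y.
Proof. by case/andP. Qed.

Lemma sub_ends_nonadjacent : ~~ sadj G' (Some u) (Some v).
Proof. by rewrite /= !eqxx andbF. Qed.

Lemma sub_triangle_old (z a b : G') :
  sadj G' z a -> sadj G' z b -> sadj G' a b -> exists x, z = Some x.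
Proof.
case: z => [x|]; first by exists x.
move=> /sub_adj_new[]-> /sub_adj_new[]->; rewrite ?sadj_irr //; last rewrite sadj_sym.
all: by rewrite (negPf sub_ends_nonadjacent).
Qed.

Lemma sub_square_old A (z a w b : G') :
  triangle_free A -> z \in sub_lift A -> w \in sub_lift A -> z != w -> a != b ->
  sadj G' z a -> sadj G' a w -> sadj G' w b -> sadj G' b z -> exists x, z = Some x.
Proof.
case: z => [x|]; first by exists x.
move=> tA; rewrite inE => /andP[Au Av] Aw; case: w Aw => [w|//]; rewrite inE => Aw _ ab Na.
have wuv : sadj G w u -> sadj G w v -> False.
  by move=> wu wv; have := tA v w u Av Aw Au; rewrite uv sadj_sym wv wu => /(_ isT isT).
rewrite sadj_sym => wa wb; rewrite sadj_sym => Nb.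
case/sub_adj_new: Na ab wa => -> ab wa; case/sub_adj_new: Nb ab wb => -> ab wb.
- by rewrite eqxx in ab.
- by case: (wuv (sub_adj_old wa) (sub_adj_old wb)).
- by case: (wuv (sub_adj_old wb) (sub_adj_old wa)).
- by rewrite eqxx in ab.
Qed.

Lemma wide_core_sub_lift A : wide_core A -> wide_core (sub_lift A).
Proof.
case=> cA tA qA; have sym a b : sadj G' a b -> sadj G' b a by rewrite sadj_sym.
split; first exact: core_sub_lift.
- move=> x y z Ax Ay Az xy yz; apply/negP=> zx.
  have [x' ex] := sub_triangle_old xy (sym _ _ zx) yz.
  have [y' ey] := sub_triangle_old yz (sym _ _ xy) zx.
  have [z' ez] := sub_triangle_old zx (sym _ _ yz) xy.
  subst x y z; move: Ax Ay Az; rewrite !inE => Ax Ay Az.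
  by have := tA x' y' z' Ax Ay Az (sub_adj_old xy) (sub_adj_old yz); rewrite (sub_adj_old zx).
- move=> x y z Ax Ay Az t At xz yt xy yz zt; apply/negP=> tx.
  have [x' ex] := sub_square_old tA Ax Az xz yt xy yz zt tx.
  have [z' ez] : exists z', z = Some z'.
    by apply: sub_square_old tA Az Ax _ _ zt tx xy yz; rewrite eq_sym.
  have [y' ey] : exists y', y = Some y'.
    by apply: sub_square_old tA Ay At yt _ yz zt tx xy; rewrite eq_sym.
  have [t' et] : exists t', t = Some t'.
    by apply: sub_square_old tA At Ay _ xz tx xy yz zt; rewrite eq_sym.
  subst x y z t; move: Ax Ay Az At; rewrite !inE => Ax Ay Az At.
  have := qA x' y' z' Ax Ay Az t' At xz yt (sub_adj_old xy) (sub_adj_old yz) (sub_adj_old zt).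
  by rewrite (sub_adj_old tx).
Qed.

Lemma degree_le_subdivide d : 1 < d -> degree_le G d -> degree_le G' d.
Proof.
move=> d2 dG z; have -> : [set: G'] = sub_lift setT by apply/setP=> -[x|]; rewrite !inE.
case: z => [x|]; first by rewrite card_nbh_sub_lift ?inE.
apply: leq_trans (subset_leq_card (nbh_sub_new _)) _.
by rewrite cards2; apply: leq_trans d2; case: (_ != _).
Qed.
End SubdividedEdge.

(** * Packings of cores *)

Definition packs (G : sgraph) (r : nat) : Prop :=
  exists s : seq {set G},
    [/\ size s = r, pairwise (fun A B : {set G} => [disjoint A & B]) s
      & {in s, forall A, core A}].

Lemma packs_map (G1 G2 : sgraph) (phi : {set G1} -> {set G2}) r :
  (forall A, core A -> core (phi A)) ->
  (forall A B : {set G1}, [disjoint A & B] -> [disjoint phi A & phi B]) ->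
  packs G1 r -> packs G2 r.
Proof.
move=> phic phid [s [<- ds cs]]; exists (map phi s); split.
- by rewrite size_map.
- by rewrite pairwise_map; apply: sub_pairwise ds => A B; apply: phid.
- by move=> _ /mapP[A As ->]; apply/phic/cs.
Qed.

Lemma packs_giso (G1 G2 : sgraph) r : giso G1 G2 -> packs G1 r -> packs G2 r.
Proof.
case/giso_embedding=> f fe; apply: (packs_map (phi := fun A => f @: A)) => [A|A B].
  by move/(core_imset fe).
by rewrite imset_disjoint //; apply: fe.1.
Qed.

Lemma packs_leq (G : sgraph) r : packs G r -> r <= #|G|.
Proof.
case=> s [<- + cs]; have {cs}: {in s, forall A : {set G}, A != set0} by move=> A /cs[].
rewrite -cardsT; have: {in s, forall A : {set G}, A \subset [set: G]} by move=> A _; apply: subsetT.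
elim: s [set: G] => //= A s IH U sU ne /andP[/allP dA ds].
rewrite -(cardsID A) -add1n leq_add //; last first.
  apply: IH ds => B Bs; last by apply: ne; rewrite inE Bs orbT.
  by rewrite subsetD sU ?inE ?Bs ?orbT // disjoint_sym dA.
by rewrite (setIidPr _) ?card_gt0 ?ne ?sU // mem_head.
Qed.

Lemma packs_subdivide (G : sgraph) (u v : G) r :
  sadj G u v -> packs G r -> packs (subdivide u v) r.
Proof.
move=> uv; apply: packs_map (core_sub_lift uv) _ => A B /pred0P AB.
apply/pred0P=> -[x|] /=; rewrite !inE; first exact: AB x.
by have := AB u; rewrite /=; do 4 case: (_ \in _).
Qed.

Lemma packs_unsubdivide (G : sgraph) (u v : G) r :
  sadj G u v -> packs (subdivide u v) r -> packs G r.
Proof.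
move=> uv; apply: packs_map (core_sub_unlift uv) _ => A B /pred0P AB.
by apply/pred0P=> x; have := AB (Some x); rewrite /= !inE.
Qed.

Lemma packs_subdivision (H G : sgraph) r : is_subdivision H G -> packs H r <-> packs G r.
Proof.
move=> sG; split.
  apply: (subdivision_preserves (P := packs^~ r)) sG => [G1 G2|G1 u v].
    exact: packs_giso.
  exact: packs_subdivide.
apply: (subdivision_preserves (P := fun G => packs G r -> packs H r)) sG _ => //.
  by move=> G1 G2 iso IH pG; apply/IH/(packs_giso (giso_sym iso)).
by move=> G1 u v uv IH pG; apply/IH/(packs_unsubdivide uv).
Qed.

Lemma subdivision_meets_cores (H G : sgraph) (S A : {set G}) :
  is_subdivision H G -> is_subdivision H (induced S) -> core A -> ~~ [disjoint A & S].
Proof.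
move=> sG sS cA; apply/negP=> dAS.
have extend r : packs H r -> packs H r.+1.
  case/(packs_subdivision r sS)=> s [sz ds cs]; apply/(packs_subdivision _ sG).
  exists (A :: map (fun C : {set induced S} => val @: C) s).
  split; rewrite /= ?size_map ?sz //.
    rewrite pairwise_map; apply/andP; split; last first.
      by apply: sub_pairwise ds => C D; rewrite /= imset_disjoint //; apply: val_inj.
    apply/allP=> _ /mapP[C _ ->]; apply: disjointWr dAS.
    by apply/subsetP=> _ /imsetP[x _ ->]; apply: valP.
  move=> B; rewrite inE => /orP[/eqP->//|/mapP[C Cs ->]].
  exact/(core_imset (embedding_val S))/cs.
have packs_all r : packs H r by elim: r => [|r IH]; [exists [::] | exact: extend].
by have := packs_leq (packs_all #|H|.+1); rewrite ltnn.
Qed.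

Lemma has_wide_core_subdivision (H G : sgraph) :
  is_subdivision H G -> has_wide_core H -> has_wide_core G.
Proof.
apply: (subdivision_preserves (P := has_wide_core)) => [G1 G2|G1 u v uv].
  by case/giso_embedding=> f fe [A A_wide]; exists (f @: A); apply: wide_core_imset.
by case=> A A_wide; exists (sub_lift u v A); apply: wide_core_sub_lift.
Qed.

Lemma degree_le_subdivision (H G : sgraph) d :
  1 < d -> #|H| <= d -> is_subdivision H G -> degree_le G d.
Proof.
move=> d2 Hd sG; apply: (subdivision_preserves (P := degree_le^~ d)) sG _.
- move=> G1 G2 [f [[g fK gK] fE]] dG x; have fI := can_inj fK.
  have fT : f @: [set: G1] = [set: G2] by apply/setP=> y; rewrite -(gK y) imset_f ?inE.
  by rewrite -fT -(gK x) nbh_imset // card_imset.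
- by move=> G1 u v uv; apply: degree_le_subdivide.
- by move=> x; apply: leq_trans (max_card _) Hd.
Qed.

(** * Stretching edges into paths *)

Section Edge.
Variable H : sgraph.

Definition edge : finType :=
  {p : H * H | sadj H p.1 p.2 && (enum_rank p.1 < enum_rank p.2)}.
Definition tail (e : edge) : H := (val e).1.
Definition head (e : edge) : H := (val e).2.

Definition joins (e : edge) (a b : H) : bool :=
  ((a == tail e) && (b == head e)) || ((a == head e) && (b == tail e)).

Lemma edge_adj e : sadj H (tail e) (head e).
Proof. by case/andP: (valP e). Qed.

Lemma tail_neq_head e : tail e != head e.
Proof. by apply: contraTneq (edge_adj e) => ->; rewrite sadj_irr. Qed.

Lemma edge_lt e : enum_rank (tail e) < enum_rank (head e).
Proof. by case/andP: (valP e). Qed.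

Lemma joinsC e a b : joins e a b = joins e b a.
Proof. by rewrite /joins orbC ![(_ == tail e) && _]andbC. Qed.

Lemma joins_unique e f : joins f (tail e) (head e) -> f = e.
Proof.
case/orP=> /andP[/eqP te /eqP he].
  by apply/val_inj/esym; rewrite [RHS]surjective_pairing [LHS]surjective_pairing; congr pair.
by have := edge_lt f; rewrite -te -he ltnNge ltnW ?edge_lt.
Qed.

Lemma joins_exists a b : sadj H a b -> exists e, joins e a b.
Proof.
move=> ab; wlog lt : a b ab / enum_rank a < enum_rank b => [W|].
  case: (ltngtP (enum_rank a) (enum_rank b)) => [|lt|/val_inj/enum_rank_inj e].
  - exact: W.
  - by rewrite sadj_sym in ab; have [e] := W _ _ ab lt; exists e; rewrite joinsC.
  - by rewrite e sadj_irr in ab.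
have abP : sadj H a b && (enum_rank a < enum_rank b) by rewrite ab.
by exists (Sub (a, b) abP); rewrite /joins /tail /head /= !eqxx.
Qed.

Lemma core_edge (A : {set H}) : core A -> 0 < #|edge|.
Proof.
move=> cA; have [/set0Pn[x xA] _] := cA.
have [y [_ _ /joins_exists[e _]]] := core_other_nbr x cA xA.
by apply/card_gt0P; exists e.
Qed.
End Edge.

(* On the vertices [inl a] and those [inr (e, j)] with [j < l e], this is [H] with each
   edge [e] replaced by a path through [inr (e, 0)], ..., [inr (e, l e - 1)]. *)
Section Stretch.
Variables (H : sgraph) (N : nat).
Local Notation vertex := (H + edge H * 'I_N)%type.
Implicit Types (l : edge H -> nat) (e f : edge H) (i j : 'I_N).

Definition unstretched l (a b : H) : bool := [forall e, joins e a b ==> (l e == 0)].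

Definition stretch_adj l (x y : vertex) : bool :=
  let end_adj a e j := ((a == tail e) && (j == 0 :> nat)) || ((a == head e) && (j.+1 == l e)) in
  match x, y with
  | inl a, inl b => sadj H a b && unstretched l a b
  | inl a, inr (e, j) | inr (e, j), inl a => end_adj a e j
  | inr (e, i), inr (f, j) => (e == f) && ((i.+1 == j :> nat) || (j.+1 == i :> nat))
  end.

Lemma stretch_adj_sym l : symmetric (stretch_adj l).
Proof.
case=> [a|[e i]] [b|[f j]] //=; last by rewrite eq_sym orbC.
by rewrite sadj_sym; congr (_ && _); apply: eq_forallb => e; rewrite joinsC.
Qed.

Lemma stretch_adj_irr l : irreflexive (stretch_adj l).
Proof. by case=> [a|[e i]] /=; rewrite ?sadj_irr // eqxx; lia. Qed.

Definition stretch l : sgraph := SGraph (stretch_adj_sym l) (stretch_adj_irr l).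

Definition stretch_support l : {set stretch l} :=
  [set x : vertex | if x is inr (e, j) then j < l e else true].

Local Notation stage l := (induced (stretch_support l)).

Lemma stretch0_is_subdivision l : (forall e, l e = 0) -> is_subdivision H (stage l).
Proof.
move=> l0; apply/subdiv_iso/(@embedding_giso_induced _ (stretch l) inl).
  split=> [a b [//]|a b] /=.
  by rewrite (_ : unstretched l a b) ?andbT //; apply/forallP=> e; rewrite l0 implybT.
move=> [a|[e j]]; rewrite inE; first by rewrite codom_f.
by rewrite l0; apply/esym/codomP=> -[].
Qed.

Section StretchStep.
Variables (l l' : edge H -> nat) (e : edge H).
Hypotheses (l_lt : l e < N) (l'_e : l' e = (l e).+1).
Hypothesis (l'_other : forall f, f != e -> l' f = l f).

(* The path of [e] grows by subdividing its final edge, from [last_vertex] to [head e]. *)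
Definition last_vertex : vertex :=
  if l e == 0 then inl (tail e) else inr (e, Ordinal (leq_ltn_trans (leq_pred _) l_lt)).

Definition new_vertex : vertex := inr (e, Ordinal l_lt).

Lemma eq_last_inl a : (inl a == last_vertex) = (a == tail e) && (l e == 0).
Proof. by rewrite /last_vertex; case: (l e =P 0) => _; rewrite ?andbT ?andbF. Qed.

Lemma eq_last_inr f j : (inr (f, j) == last_vertex) = (f == e) && (j.+1 == l e).
Proof.
rewrite /last_vertex; case: (l e =P 0) => [->|ne]; first by rewrite andbF.
rewrite (inj_eq (@inr_inj _ _)) xpair_eqE -[_ == Ordinal _]val_eqE /=.
by congr (_ && _); lia.
Qed.

Lemma stretch_adj_new (x : vertex) : x \in stretch_support l ->
  stretch_adj l' new_vertex x = (x == last_vertex) || (x == inl (head e)).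
Proof.
case: x => [a|[f j]]; rewrite inE => /= jl.
  by rewrite eq_last_inl l'_e eqxx andbT.
rewrite eq_last_inr orbF eq_sym; case: eqVneq jl => // -> jl /=; lia.
Qed.

Lemma unstretched_step a b :
  unstretched l' a b = unstretched l a b && ~~ (joins e a b && (l e == 0)).
Proof.
apply/forallP/andP=> [l'0|[/forallP l0 eN] f].
  have eN : ~~ joins e a b by have := l'0 e; rewrite l'_e implybF.
  rewrite (negPf eN); split=> //; apply/forallP=> f; apply/implyP=> fab.
  have fe : f != e by apply: contraNneq eN => <-.
  by have := l'0 f; rewrite fab l'_other.
apply/implyP=> fab; have := l0 f; rewrite fab /= => lf0.
case: (eqVneq f e) => [fe|/l'_other->//]; subst f.
by rewrite fab lf0 in eN.
Qed.

Lemma stretch_adj_old (x y : vertex) : x \in stretch_support l -> y \in stretch_support l ->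
  stretch_adj l' x y = stretch_adj l x y &&
    ~~ ((x == last_vertex) && (y == inl (head e)) || (x == inl (head e)) && (y == last_vertex)).
Proof.
wlog: x y / match x, y with inr _, inl _ => false | _, _ => true end => [W|].
  case: x y => [a|p] [b|q] xS yS; try exact: W.
  by rewrite orbC ![(inr p == _) && _]andbC !(stretch_adj_sym _ (inr p)) W.
case: x y => [a|[f i]] [b|[g j]] // _; rewrite !inE => xS yS.
- rewrite !eq_last_inl !(inj_eq (@inl_inj _ _)) /= -andbA; congr (_ && _).
  by rewrite andbAC andbA -andb_orl unstretched_step.
- rewrite eq_last_inl eq_last_inr /= andbF /=.
  case: (eqVneq g e) yS => [->|ge] yS; last by rewrite l'_other // andbF andbT.
  rewrite l'_e (inj_eq (@inl_inj _ _)) /=.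
  case: (eqVneq a (tail e)) => [->|_]; first by rewrite (negPf (tail_neq_head e)) /= orbF andbT.
  by case: (a == head e) => /=; lia.
- by rewrite /= !andbF andbT.
Qed.

Lemma stretch_support_step :
  stretch_support l' = new_vertex |: stretch_support l :> {set vertex}.
Proof.
apply/setP=> -[a|[f j]]; rewrite !inE //=.
rewrite (inj_eq (@inr_inj _ _)) xpair_eqE -[_ == Ordinal _]val_eqE /=.
by case: (eqVneq f e) => [->|/l'_other->] //; rewrite l'_e ltnS leq_eqVlt.
Qed.

Lemma stretchS_is_subdivision : is_subdivision H (stage l) -> is_subdivision H (stage l').
Proof.
move=> sl.
have lastS : last_vertex \in stretch_support l.
  by rewrite /last_vertex inE; case: (l e =P 0) => //=; lia.
have headS : (inl (head e) : stretch l) \in stretch_support l by rewrite inE.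
pose u : stage l := Sub last_vertex lastS; pose v : stage l := Sub (inl (head e)) headS.
have uv : sadj (stage l) u v.
  rewrite /= /ind_adj /= /last_vertex; case: (l e =P 0) => [le0|ne] /=.
    by rewrite edge_adj; apply/forallP=> f; apply/implyP=> /joins_unique->; rewrite le0.
  by rewrite eqxx prednK ?eqxx ?orbT // lt0n; apply/eqP.
have newS (x : stage l) : val x != new_vertex :> vertex.
  by apply: contraTneq (valP x) => /= ->; rewrite inE /= ltnn.
apply: (subdiv_step sl uv).
apply: (@embedding_giso_induced (subdivide u v) (stretch l') (oapp val new_vertex)).
  split.
    case=> [x|] [y|] //= => [/val_inj->//|/eqP|/esym/eqP].
      by rewrite (negPf (newS x)).
    by rewrite (negPf (newS y)).
  case=> [x|] [y|].
  - exact: stretch_adj_old (valP x) (valP y).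
  - by rewrite sadj_sym; apply: stretch_adj_new (valP x).
  - exact: stretch_adj_new (valP y).
  - exact: stretch_adj_irr.
move=> x; rewrite stretch_support_step in_setU1; apply/orP/codomP.
  by case=> [/eqP->|xS]; [exists None | exists (Some (Sub x xS))].
by case=> -[y|] ->; [right; apply: valP | left].
Qed.
End StretchStep.

Lemma stretch_is_subdivision l : (forall e, l e <= N) -> is_subdivision H (stage l).
Proof.
move: {2}(\sum_e l e) (erefl (\sum_e l e)) => m; elim: m l => [|m IH] l sum_l leN.
  apply: stretch0_is_subdivision => e; apply/eqP.
  by move/eqP: sum_l; rewrite sum_nat_eq0 => /forallP/(_ e).
have [e l_gt0] : exists e, 0 < l e.
  apply/existsP; apply: contra_eqT sum_l => /existsPn l0.
  by rewrite big1 // => e _; have := l0 e; rewrite lt0n negbK => /eqP.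
pose l0 f := l f - (f == e).
have lt : l0 e < N by rewrite /l0 eqxx; have := leN e; lia.
apply: (stretchS_is_subdivision (l := l0) lt).
- by rewrite /l0 eqxx; lia.
- by move=> f /negPf ne; rewrite /l0 ne subn0.
apply: IH => [|f]; last by rewrite /l0; have := leN f; lia.
move: sum_l; rewrite (bigD1 e) //= (bigD1 e (F := l0)) //= /l0 eqxx.
by under [X in _ -> _ + X = _]eq_bigr => f /negPf-> do rewrite subn0; lia.
Qed.

Local Notation full_stretch := (stretch (fun=> N)).

Lemma full_stretch_is_subdivision : is_subdivision H full_stretch.
Proof.
have sub := stretch_is_subdivision (l := fun=> N) (fun=> leqnn N).
apply: subdivision_giso sub (giso_sym _).
apply: (@embedding_giso_induced full_stretch full_stretch id); first by split.
by case=> [a|[e j]]; rewrite inE ?ltn_ord; apply/esym/codomP; eexists.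
Qed.

Lemma core_stretch_inner (A : {set full_stretch}) : 0 < N -> core A -> exists p, inr p \in A.
Proof.
move=> N_gt0 cA; have [/set0Pn[[a|p] xA] _] := cA; last by exists p.
have [[b|p] [yA _ ab]] := core_other_nbr (inl a : full_stretch) cA xA; last by exists p.
have [ab' /forallP N0] := andP ab; have [e je] := joins_exists ab'.
by have := N0 e; rewrite je eqn0Ngt N_gt0.
Qed.

(* The interior vertices of a path have degree 2, so both neighbours stay in a core. *)
Lemma core_stretch_next (A : {set full_stretch}) e i j :
  core A -> inr (e, i) \in A -> (i.+1 == j :> nat) || (j.+1 == i :> nat) -> inr (e, j) \in A.
Proof.
move=> [_ dA] /dA/card_gt1P[x [y [xN yN xy]]] ij; apply: contraNT xy => jA.
have neq_j (k : 'I_N) : inr (e, k) \in A -> (k < N) && (k != j :> nat).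
  by rewrite ltn_ord; apply: contraTneq => /val_inj->.
have ltj := ltn_ord j; move: xN yN; rewrite !inE; case: x y => [a|[f k]] [b|[g m]].
- case/andP=> _ /= ai /andP[_ /= bi]; apply/eqP.
  by case/orP: ai => /andP[/eqP-> ai]; case/orP: bi => /andP[/eqP-> bi] //; lia.
- case/andP=> _ /= ai /andP[mA /= /andP[/eqP eg mi]]; subst g.
  by have mj := neq_j m mA; exfalso; case/orP: ai => /andP[_ ai]; lia.
- case/andP=> kA /= /andP[/eqP ef ki] /andP[_ /= bi]; subst f.
  by have kj := neq_j k kA; exfalso; case/orP: bi => /andP[_ bi]; lia.
- case/andP=> kA /= /andP[/eqP ef ki] /andP[mA /= /andP[/eqP eg mi]]; subst f g.
  have kj := neq_j k kA; have mj := neq_j m mA.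
  by apply/eqP; congr inr; congr pair; apply: ord_inj; lia.
Qed.

Lemma core_stretch_path (A : {set full_stretch}) :
  0 < N -> core A -> exists e, forall j, inr (e, j) \in A.
Proof.
move=> N_gt0 cA; have [[e i] iA] := core_stretch_inner N_gt0 cA; exists e.
suff dist d j : (i + d == j) || (j + d == i) -> inr (e, j) \in A.
  by move=> j; case: (leqP i j) => ij; [apply: (dist (j - i)) | apply: (dist (i - j))]; lia.
elim: d j => [|d IH] j; first by rewrite !addn0 [j == i :> nat]eq_sym orbb => /eqP/ord_inj <-.
case/orP=> /eqP ij.
  have lt : j.-1 < N by have := ltn_ord j; lia.
  by apply: (core_stretch_next (i := Ordinal lt)) => //; [apply: IH|]; rewrite /=; lia.
have lt : j.+1 < N by have := ltn_ord i; lia.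
by apply: (core_stretch_next (i := Ordinal lt)) => //; [apply: IH|]; rewrite /=; lia.
Qed.
End Stretch.

(** * Subdivisions with gates *)

Section Gated.
Variables (H : sgraph) (K : finType).
Local Notation N := (#|K| * 2).
Local Notation vertex := ((H + edge H * K) + edge H * K)%type.

Definition position (k : K) (b : bool) : nat := enum_rank k * 2 + b.

Lemma position_lt k b : position k b < N.
Proof. by have kK : enum_rank k < #|K| := ltn_ord _; rewrite /position; case: b; lia. Qed.

(* The gates [inr (e, k)] occupy the odd positions of the path of [e]. *)
Definition stretch_vertex (x : vertex) : H + edge H * 'I_N :=
  match x with
  | inl (inl a) => inl a
  | inl (inr (e, k)) => inr (e, Ordinal (position_lt k false))
  | inr (e, k) => inr (e, Ordinal (position_lt k true))
  end.

Lemma position_inj k b k' b' : position k b = position k' b' -> k = k' /\ b = b'.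
Proof.
rewrite /position => e; suff: (enum_rank k = enum_rank k' :> nat) /\ b = b'.
  by case=> /val_inj/enum_rank_inj.
by move: e; case: b b' => -[]; lia.
Qed.

Lemma stretch_vertex_inj : injective stretch_vertex.
Proof.
case=> [[a|[e k]]|[e k]] [[a'|[e' k']]|[e' k']] //= []; first by move=> ->.
all: by move=> -> /position_inj[] // ->.
Qed.

Definition gated_adj : rel vertex := relpre stretch_vertex (stretch_adj (fun=> N)).
Lemma gated_adj_sym : symmetric gated_adj.
Proof. by move=> x y; apply: stretch_adj_sym. Qed.
Lemma gated_adj_irr : irreflexive gated_adj.
Proof. by move=> x; apply: stretch_adj_irr. Qed.
Definition gated : sgraph := SGraph gated_adj_sym gated_adj_irr.

Lemma stretch_vertex_embedding :
  @embedding gated (stretch N (fun=> N)) stretch_vertex.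
Proof. by split; first exact: stretch_vertex_inj. Qed.

Lemma gated_is_subdivision : is_subdivision H gated.
Proof.
apply: subdivision_giso (full_stretch_is_subdivision H N) (giso_sym _).
apply: embedding_giso stretch_vertex_embedding _.
by rewrite !card_sum !card_prod card_ord; lia.
Qed.

Lemma gates_nonadjacent x y : ~~ gated_adj (inr x) (inr y).
Proof.
by case: x y => [e k] [f k']; rewrite /gated_adj /= /position; case: (e == f) => /=; lia.
Qed.

Lemma core_gated (A : {set gated}) : 0 < #|K| -> core A ->
  exists2 e, (forall k, inr (e, k) \in A) & #|K| <= #|[set p | inl p \in A]|.
Proof.
move=> K_gt0 /(core_imset stretch_vertex_embedding)/core_stretch_path[|e pathA]; first lia.
have inA x : stretch_vertex x \in stretch_vertex @: A -> x \in A.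
  by rewrite mem_imset //; apply: stretch_vertex_inj.
exists e => [k|]; first exact/inA/pathA.
have path_inj : injective (fun k => inr (e, k) : H + edge H * K) by move=> k k' [].
rewrite -cardsT -(card_imset _ path_inj); apply/subset_leq_card/subsetP=> _ /imsetP[k _ ->].
by rewrite inE; apply/inA/pathA.
Qed.
End Gated.

(** * Weaving copies along gates *)

Section Weave.
Variables (n : nat) (P E : finType).
Local Notation path := ('I_n * E)%type.
Local Notation gate := (E * path)%type.
Variables (adjB : rel (P + gate)) (adjB_sym : symmetric adjB) (adjB_irr : irreflexive adjB).
Local Notation B := (SGraph adjB_sym adjB_irr).
Hypothesis gates_indep : forall x y, ~~ adjB (inr x) (inr y).

(* The gate [(i, (f, j))] of [B] lies on its path [i].  In copy [e] it is identified with
   the gate [(j, (e, i))] of copy [f] when [e != f], and is not shared when [e = f]. *)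
Definition glue (e : 'I_n) (x : gate) : path * path :=
  if e <= x.2.1 then ((e, x.1), x.2) else (x.2, (e, x.1)).

Definition weave_vertex : finType := ('I_n * P + path * path)%type.

(* Holds also when [y] is no gate of copy [w.1]. *)
Definition private_gate_adj (w : 'I_n * P) (y : path * path) : bool :=
  [forall x, (glue w.1 x == y) ==> adjB (inl w.2) (inr x)].

Definition weave_adj (v w : weave_vertex) : bool :=
  match v, w with
  | inl a, inl b => (a.1 != b.1) || adjB (inl a.2) (inl b.2)
  | inl a, inr y | inr y, inl a => private_gate_adj a y
  | inr _, inr _ => false
  end.

Lemma weave_adj_sym : symmetric weave_adj.
Proof. by case=> [a|x] [b|y] //=; rewrite eq_sym adjB_sym. Qed.

Lemma weave_adj_irr : irreflexive weave_adj.
Proof. by case=> [a|x] //=; rewrite eqxx adjB_irr. Qed.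

Definition weave : sgraph := SGraph weave_adj_sym weave_adj_irr.

Definition copy (e : 'I_n) (b : B) : weave :=
  match b with inl p => inl (e, p) | inr x => inr (glue e x) end.

Lemma glue_inj e : injective (glue e).
Proof.
move=> [i k] [j l]; rewrite /glue /=; case: ifP => le1; case: ifP => le2 [] //.
- by move=> -> ->.
- by move=> kl; rewrite -kl leqnn in le2.
- by move=> kl; rewrite kl leqnn in le1.
- by move=> -> ->.
Qed.

Lemma glue_shared e f i j : e != f -> glue e (i, (f, j)) = glue f (j, (e, i)).
Proof. by rewrite /glue /= -val_eqE /=; case: ltngtP. Qed.

Lemma copy_embedding e : embedding (copy e).
Proof.
have adj_gate p x : private_gate_adj (e, p) (glue e x) = adjB (inl p) (inr x).
  apply/forallP/idP => [/(_ x)|px y]; first by rewrite eqxx.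
  by apply/implyP=> /eqP/glue_inj->.
split; first by case=> [p|x] [q|y] //= [] => [->|/glue_inj->].
case=> [p|x] [q|y] /=.
- by rewrite eqxx.
- exact: adj_gate.
- by rewrite adj_gate adjB_sym.
- by rewrite (negPf (gates_indep x y)).
Qed.

Lemma adj_private_outside e p v : v \notin codom (copy e) -> sadj weave (inl (e, p)) v.
Proof.
case: v => [[f q]|y] vN /=.
  by apply/orP; left; apply: contraNneq vN => <-; apply: (codom_f (copy e) (inl q)).
apply/forallP=> x; apply/implyP=> /eqP yx.
by rewrite -yx (codom_f (copy e) (inr x)) in vN.
Qed.

Lemma core_gate_private_nbr (A : {set weave}) y (v : weave) : core A -> inr y \in A ->
  exists w, [/\ inl w \in A, v != inl w :> weave & sadj weave (inr y) (inl w)].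
Proof.
by move=> cA /(core_other_nbr v cA)[[w|z] [wA vw yw]] //; exists w.
Qed.

Section WideCore.
Variable A : {set weave}.
Hypothesis A_wide : wide_core A.
Let A_core : core A. Proof. by case: A_wide. Qed.
Let no_triangle : triangle_free A. Proof. by case: A_wide. Qed.
Let no_square : square_free A. Proof. by case: A_wide. Qed.

Lemma wide_core_gate_nbr e p f q y :
  inl (e, p) \in A -> inl (f, q) \in A -> inr y \in A ->
  sadj weave (inl (e, p)) (inr y) -> e = f.
Proof.
move=> pA qA yA py; apply/eqP; apply: contraT => ef.
have [[g r] [rA pr yr]] := core_gate_private_nbr (inl (e, p)) A_core yA.
case: (eqVneq g e) => [ge|ge].
  have rq : sadj weave (inl (g, r)) (inl (f, q)) by rewrite /= ge ef.
  have qp : sadj weave (inl (f, q)) (inl (e, p)) by rewrite /= eq_sym ef.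
  by have := no_square pA yA rA qA pr isT py yr rq; rewrite qp.
have rp : sadj weave (inl (g, r)) (inl (e, p)) by rewrite /= ge.
by have := no_triangle pA yA rA py yr; rewrite rp.
Qed.

Lemma wide_core_private_copy e p f q : inl (e, p) \in A -> inl (f, q) \in A -> e = f.
Proof.
move=> pA qA; apply/eqP; apply: contraT => ef.
have pq : sadj weave (inl (e, p)) (inl (f, q)) by rewrite /= ef.
have qp : sadj weave (inl (f, q)) (inl (e, p)) by rewrite sadj_sym.
have [[[g r]|y] [aA qa pa]] := core_other_nbr (inl (f, q) : weave) A_core pA; last first.
  by case/eqP: ef; apply: wide_core_gate_nbr pA qA aA pa.
have [[[h s]|y] [bA pb qb]] := core_other_nbr (inl (e, p) : weave) A_core qA; last first.
  by case/eqP: ef; apply/esym; apply: wide_core_gate_nbr qA pA bA qb.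
have gf : g = f.
  apply/eqP; apply: contraT => gf.
  by have := no_triangle pA aA qA pa; rewrite qp /= gf => /(_ isT).
have he : h = e.
  apply/eqP; apply: contraT => he.
  by have := no_triangle qA bA pA qb; rewrite pq /= he => /(_ isT).
have ba : sadj weave (inl (h, s)) (inl (g, r)) by rewrite /= gf he ef.
have ap : sadj weave (inl (g, r)) (inl (e, p)) by rewrite sadj_sym.
by have := no_square pA qA bA aA pb qa pq qb ba; rewrite ap.
Qed.

Lemma wide_core_in_copy : exists e, A \subset codom (copy e).
Proof.
have sym v w : sadj weave v w -> sadj weave w v by rewrite sadj_sym.
have [e [p pA]] : exists e p, inl (e, p) \in A.
  have [/set0Pn[[[e p]|x] xA] _] := A_core; first by exists e, p.
  by have [[e p] [pA _ _]] := core_gate_private_nbr (inr x) A_core xA; exists e, p.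
exists e; apply/subsetP=> -[[f q]|x] xA.
  by rewrite (wide_core_private_copy xA pA) (codom_f (copy e) (inl q)).
apply: contraT => x_out.
have x_adj f q : inl (f, q) \in A -> sadj weave (inl (f, q)) (inr x).
  by move=> qA; rewrite (wide_core_private_copy qA pA) adj_private_outside.
have xp := sym _ _ (x_adj _ _ pA).
have [z [zA xz pz]] := core_other_nbr (inr x : weave) A_core pA.
case: z => [[f q]|z] in zA xz pz.
  by have := no_triangle xA pA zA xp pz; rewrite x_adj.
have [[f q] [qA pq zq]] := core_gate_private_nbr (inl (e, p)) A_core zA.
by have := no_square xA pA zA qA xz pq xp pz zq; rewrite x_adj.
Qed.
End WideCore.

Variable H : sgraph.
Hypotheses (subB : is_subdivision H B) (H_wide : has_wide_core H).
Hypothesis n_large : #|H| + 2 < n.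
Hypothesis coreB : forall A : {set B}, core A ->
  exists2 i, (forall k, inr (i, k) \in A) & n <= #|[set p | inl p \in A]|.

Lemma subdivision_core_in_copy (S : {set weave}) : is_subdivision H (induced S) ->
  exists e, S \subset codom (copy e) /\ exists2 A : {set B}, core A & copy e @: A \subset S.
Proof.
move=> sS; have [C C_wide] := has_wide_core_subdivision sS H_wide.
have D_wide := wide_core_imset (embedding_val S) C_wide.
set D := _ @: _ in D_wide; have [e De] := wide_core_in_copy D_wide.
have DS : D \subset S by apply/subsetP=> _ /imsetP[x _ ->]; apply: valP.
have coreA : core (copy e @^-1: D).
  by case: D_wide => cD _ _; apply: core_preimset cD; first exact: copy_embedding.
set A := _ @^-1: _ in coreA.
have AS : copy e @: A \subset S.
  by apply: subset_trans DS; apply/subsetP=> _ /imsetP[b + ->]; rewrite inE.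
exists e; split; last by exists A.
apply/subsetP=> v vS; apply: contraT => v_out.
have [i _ many_privates] := coreB coreA.
have deg_v : #|nbh S v| <= #|H| + 2.
  rewrite -(card_nbh_induced (Sub v vS)).
  by apply: (degree_le_subdivision _ _ sS); lia.
suff : #|[set p | inl p \in A]| <= #|nbh S v| by lia.
have priv_inj : injective (fun p => inl (e, p) : weave) by move=> p q [].
rewrite -(card_imset _ priv_inj); apply/subset_leq_card/subsetP=> _ /imsetP[p + ->].
rewrite !inE => pA; rewrite sadj_sym adj_private_outside // andbT.
exact: (subsetP DS _ pA).
Qed.

Lemma weave_no_disjoint_subdivisions (S1 S2 : {set weave}) :
  is_subdivision H (induced S1) -> is_subdivision H (induced S2) -> ~~ [disjoint S1 & S2].
Proof.
move=> sS1 sS2.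
have [e [S1e [A1 cA1 A1S]]] := subdivision_core_in_copy sS1.
have [f [_ [A2 cA2 A2S]]] := subdivision_core_in_copy sS2.
case: (eqVneq e f) => [fe|ef].
  subst f; pose S := copy e @^-1: S1.
  have sS : is_subdivision H (induced S).
    exact: subdivision_giso sS1 (giso_sym (giso_induced_preimset (copy_embedding e) S1e)).
  have := subdivision_meets_cores subB sS cA2; apply: contraNN => dS.
  rewrite disjoint_sym; apply: disjointWr (_ : [disjoint S & copy e @^-1: S2]).
    by apply/subsetP=> b bA; rewrite inE; apply: (subsetP A2S); apply: imset_f.
  by move: dS; rewrite -!setI_eq0 -preimsetI => /eqP->; rewrite preimset0.
have [[i gi _] [j gj _]] := (coreB cA1, coreB cA2).
apply/negP=> /pred0P/(_ (copy e (inr (i, (f, j))))) /=.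
have -> : copy e (inr (i, (f, j))) \in S1 by apply: (subsetP A1S); apply: imset_f.
suff -> : copy e (inr (i, (f, j))) \in S2 by [].
by rewrite /= (glue_shared i j ef); apply: (subsetP A2S); apply/imsetP; exists (inr (j, (e, i))).
Qed.

Definition copies (v : weave) : {set 'I_n} :=
  match v with inl w => [set w.1] | inr (k, l) => [set k.1; l.1] end.

Lemma mem_copies e b : e \in copies (copy e b).
Proof.
case: b => [p|[i k]] /=; first by rewrite !inE.
by rewrite /glue; case: ifP => _; rewrite !inE eqxx ?orbT.
Qed.

Lemma card_copies v : #|copies v| <= 2.
Proof. by case: v => [w|[k l]] /=; rewrite ?cards1 // cards2; case: (_ != _). Qed.

Lemma weave_subdivision_avoiding (X : {set weave}) : #|X| * 2 < n ->
  exists2 S : {set weave}, is_subdivision H (induced S) & [disjoint S & X].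
Proof.
move=> Xn; have : ~~ ([set: 'I_n] \subset \bigcup_(v in X) copies v).
  apply: contraL Xn => /subset_leq_card; rewrite cardsT card_ord -leqNgt => /leq_trans-> //.
  rewrite -sum_nat_const; elim/big_rec2: _ => [|v U m _ IH]; first by rewrite cards0.
  by apply: leq_trans (leq_card_setU _ _) _; rewrite leq_add ?card_copies.
case/subsetPn=> e _ eN; exists [set v in codom (copy e)].
  apply: subdivision_giso subB _.
  by apply: embedding_giso_induced (copy_embedding e) _ => v; rewrite inE.
apply/pred0P=> v /=; rewrite inE; apply/negP=> /andP[/codomP[b ->] bX].
by case/bigcupP: eN; exists (copy e b) => //; apply: mem_copies.
Qed.
End Weave.

Lemma long_cycle_has_wide_core (H : sgraph) : has_induced_long_cycle H -> has_wide_core H.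
Proof.
case=> C [m [m5 /giso_embedding[g g_emb]]].
exists ((val \o g) @: [set: 'I_m]); apply: wide_core_imset (wide_core_cycle m5).
exact: embedding_comp g_emb (embedding_val C).
Qed.

Theorem mainTheorem4 (H : sgraph) :
  has_induced_long_cycle H -> ~ induced_EP H.
Proof.
move=> /long_cycle_has_wide_core H_wide [f EP_f].
pose n := f 2 * 2 + #|H| + 3; pose K := ('I_n * edge H)%type.
have subB := gated_is_subdivision H K; have gates_indep := @gates_nonadjacent H K.
pose W := weave (gated_adj_sym (H := H) (K := K)) (gated_adj_irr (K := K)).
have [[F [sF dF]]|[X [Xf hit]]] := EP_f W 2 isT; last first.
  have [|S sS dS] := weave_subdivision_avoiding gates_indep subB (X := X).
    by apply: leq_ltn_trans (leq_mul Xf (leqnn 2)) _; rewrite /n; lia.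
  by have := hit S sS; rewrite dS.
have n_large : #|H| + 2 < n by rewrite /n; lia.
have K_ge_n : n <= #|{: K}|.
  by have [A [/core_edge e_gt0 _ _]] := H_wide; rewrite card_prod card_ord leq_pmulr.
have coreB (A : {set gated H K}) : core A ->
    exists2 e, (forall k, inr (e, k) \in A) & n <= #|[set p | inl p \in A]|.
  by case/core_gated=> [|e gA /(leq_trans K_ge_n)]; [apply: leq_trans K_ge_n; lia | exists e].
have := weave_no_disjoint_subdivisions gates_indep subB H_wide n_large coreB (sF ord0) (sF ord_max).
by rewrite dF.
Qed.
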